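(* Let $S\in\mathbb R^{N\times N}$ be skew-symmetric and assume the underlying Runge-Kutta method is explicit or diagonally implicit (i.e. $a_{ij}=0$ for $j>i$). Apply the IDT method (see context), taking $K$ steps, to $y'(t)=Sy(t)$, $y(0)=y_{\rm init}$, with entropy function $\eta(y)=\tfrac12\|y\|^2$. Then the IDT method preserves time-symmetry. In particular, if adjoint IDT (see context) is applied with $\lambda_K=y_K$, $w_{k-1}=0$ and $W_k=0$ for $k=1,\dots,K$, then $\lambda_k=y_k$ for all time steps $k=0,1,\dots,K$.
   Context: Fix an $s$-stage Runge-Kutta method with real coefficients $a_{ij},b_i$ ($1\le i,j\le s$), step size $\Delta t>0$, and a number of steps $K$; $\|\cdot\|$ is the Euclidean norm. ''Time-symmetry'' means that each adjoint time step reverses the corresponding forward time step. IDT (incremental direction technique) method for $y'=Sy$: $y_0=y_{\rm init}$ and, for $k=1,\dots,K$, $$Y_{k,i}=y_{k-1}+\Delta t\sum_{j=1}^s a_{ij}SY_{k,j}\ (i=1,\dots,s),\qquad y_k=y_{k-1}+\gamma_k\Delta t\sum_{i=1}^s b_iSY_{k,i},$$ where the relaxation parameter $\gamma_k$ is the non-zero root closest to $1$ of $r(\,\cdot\,;y_{k-1},Y_k)$, $Y_k=(Y_{k,1},\dots,Y_{k,s})$, with $$r(\gamma;y,Y)=\eta\Big(y+\gamma\Delta t\sum_{i}b_iSY_{i}\Big)-\eta(y)-\gamma\Delta t\sum_{i}b_i\nabla\eta(Y_{i})^\top SY_{i}$$ for $y\in\mathbb R^N$, $Y=(Y_1,\dots,Y_s)\in\mathbb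 R^{sN}$ independent variables. It is assumed that at each step the root $\gamma_k$ exists and that $\partial r/\partial\gamma\ne0$ at it. The gradients of $\gamma_k$ are defined by implicit differentiation: $$(\nabla_y\gamma_k)^\top=-\Big(\frac{\partial r}{\partial\gamma}\Big)^{-1}\frac{\partial r}{\partial y},\qquad(\nabla_Y\gamma_{k,i})^\top=-\Big(\frac{\partial r}{\partial\gamma}\Big)^{-1}\frac{\partial r}{\partial Y_i},\qquad\text{evaluated at }(\gamma_k;y_{k-1},Y_k).$$ Adjoint IDT method (about the IDT solution $y_k,Y_k,\gamma_k$): given $\lambda_K\in\mathbb R^N$ and source terms $w_{k-1}\in\mathbb R^N$, $W_k=(W_{k,1},\dots,W_{k,s})\in\mathbb R^{sN}$, for $k=K,K-1,\dots,1$, $$\xi_k=\Delta t\sum_{i=1}^s b_i(SY_{k,i})^\top\lambda_k,$$ $$\Lambda_{k,i}=\Delta t\,S^\top\Big(\gamma_kb_i\lambda_k+\sum_{j=1}^s a_{ji}\Lambda_{k,j}\Big)+\xi_k\nabla_Y\gamma_{k,i}+W_{k,i}\ (i=1,\dots,s),$$ $$\lambda_{k-1}=\lambda_k+\sum_{i=1}^s\Lambda_{k,i}+\xi_k\nabla_y\gamma_k+w_{k-1}.$$ *)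

(* Defs.v *)
From HB Require Import structures.
From mathcomp Require Import all_boot all_order all_algebra.
From mathcomp Require Import all_classical all_reals all_analysis.

Set Implicit Arguments.
Unset Strict Implicit.
Unset Printing Implicit Defensive.

Import Order.TTheory GRing.Theory Num.Theory.
Import numFieldNormedType.Exports.

Local Open Scope ring_scope.

Section Calculus.
Context {R : realType} {N : nat}.

Definition dot (u v : 'cV[R]_N) : R := (u^T *m v) 0 0.

(* The library's norm on matrices is the sup norm, hence this definition. *)
Definition enorm (u : 'cV[R]_N) : R := Num.sqrt (\sum_i u i 0 ^+ 2).

Definition half_sqnorm (u : 'cV[R]_N) : R := 2^-1 * enorm u ^+ 2.

(* Column vector of partial derivatives, i.e. the transpose of df/dy. *)
Definition gradient (f : 'cV[R]_N -> R^o) (y : 'cV[R]_N) : 'cV[R]_N :=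
  \col_i 'D_(delta_mx i 0) f y.

End Calculus.

Section IDT.
Context {R : realType} {N s : nat}.
Context (A : 'M[R]_s) (b : 'cV[R]_s) (dt : R).
Context (S : 'M[R]_N) (eta : 'cV[R]_N -> R).

Implicit Types (y lam w : 'cV[R]_N) (Y Lam W : 'I_s -> 'cV[R]_N) (gam : R).

Definition entropy_residual gam y Y : R :=
  eta (y + (gam * dt) *: \sum_i b i 0 *: (S *m Y i)) - eta y
  - gam * dt * \sum_i b i 0 * dot (gradient eta (Y i)) (S *m Y i).

Definition residual_dgamma gam y Y : R :=
  derive1 (fun g : R => entropy_residual g y Y : R^o) gam.

Definition residual_grad_y gam y Y : 'cV[R]_N :=
  gradient (fun x => entropy_residual gam x Y) y.

(* Gradient with respect to the i-th stage, the other stages being fixed. *)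
Definition residual_grad_Y gam y Y (i : 'I_s) : 'cV[R]_N :=
  gradient (fun x => entropy_residual gam y [eta Y with i |-> x]) (Y i).

Definition relaxation_parameter gam y Y : Prop :=
  [/\ gam != 0, entropy_residual gam y Y = 0 &
      forall g : R, g != 0 -> entropy_residual g y Y = 0 ->
        `|gam - 1| <= `|g - 1|].

Definition gamma_grad_y gam y Y : 'cV[R]_N :=
  - ((residual_dgamma gam y Y)^-1 *: residual_grad_y gam y Y).

Definition gamma_grad_Y gam y Y (i : 'I_s) : 'cV[R]_N :=
  - ((residual_dgamma gam y Y)^-1 *: residual_grad_Y gam y Y i).

Definition idt_step yprev Y gam ynext : Prop :=
  [/\ forall i, Y i = yprev + dt *: \sum_j A i j *: (S *m Y j),
      relaxation_parameter gam yprev Y,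
      residual_dgamma gam yprev Y != 0 &
      ynext = yprev + (gam * dt) *: \sum_i b i 0 *: (S *m Y i)].

(* The values Y 0, gam 0 and those at indices above K are unconstrained and
   play no role. *)
Definition idt_solution (K : nat) (yinit : 'cV[R]_N) (y : nat -> 'cV[R]_N)
    (Y : nat -> 'I_s -> 'cV[R]_N) (gam : nat -> R) : Prop :=
  y 0%N = yinit /\
  forall k, (1 <= k <= K)%N -> idt_step (y k.-1) (Y k) (gam k) (y k).

Definition adjoint_xi Y lam : R := dt * \sum_i b i 0 * dot (S *m Y i) lam.

(* [yprev], [Y] and [gam] come from the forward step; the adjoint step goes
   from [lam] to [lamprev]. *)
Definition adjoint_idt_step yprev Y gam w W lam Lam lamprev : Prop :=
  (forall i, Lam i =
     dt *: (S^T *m ((gam * b i 0) *: lam + \sum_j A j i *: Lam j))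
     + adjoint_xi Y lam *: gamma_grad_Y gam yprev Y i + W i) /\
  lamprev = lam + \sum_i Lam i + adjoint_xi Y lam *: gamma_grad_y gam yprev Y
            + w.

Definition adjoint_idt_solution (K : nat) (y : nat -> 'cV[R]_N)
    (Y : nat -> 'I_s -> 'cV[R]_N) (gam : nat -> R)
    (lamK : 'cV[R]_N) (w : nat -> 'cV[R]_N) (W : nat -> 'I_s -> 'cV[R]_N)
    (lam : nat -> 'cV[R]_N) (Lam : nat -> 'I_s -> 'cV[R]_N) : Prop :=
  lam K = lamK /\
  forall k, (1 <= k <= K)%N ->
    adjoint_idt_step (y k.-1) (Y k) (gam k) (w k.-1) (W k)
      (lam k) (Lam k) (lam k.-1).

(* The k-th adjoint step without sources, started from y_k, has y_{k-1} as its
   one possible outcome; in particular its implicit stages are solvable. *)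
Definition time_symmetric (K : nat) (y : nat -> 'cV[R]_N)
    (Y : nat -> 'I_s -> 'cV[R]_N) (gam : nat -> R) : Prop :=
  forall k, (1 <= k <= K)%N -> forall lamprev,
    (exists Lam, adjoint_idt_step (y k.-1) (Y k) (gam k) 0 (fun=> 0)
                   (y k) Lam lamprev)
    <-> lamprev = y k.-1.

End IDT.

(* Main.v *)
Require Import Defs.
From HB Require Import structures.
From mathcomp Require Import all_boot all_order all_algebra.
From mathcomp Require Import all_classical all_reals all_analysis.
From mathcomp Require Import ring.

Set Implicit Arguments.
Unset Strict Implicit.
Unset Printing Implicit Defensive.

Import Order.TTheory GRing.Theory Num.Theory.
Import numFieldNormedType.Exports.

Local Open Scope ring_scope.

(** For the entropy half the squared norm, the production term of the residual
    vanishes because S is skew, so that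
      r(g; y, Y) = eta (y + g dt d) - eta y,  with  d = sum_i b_i S Y_i.
    Write y_k = y_{k-1} + gamma dt d.  Differentiating in gamma gives
    dr/dgamma = dt <d, y_k>, which is exactly the scalar xi of the adjoint step
    started from lambda_k = y_k.  The factor xi therefore cancels the
    denominator in the implicit derivatives of gamma, and the two correction
    terms of the adjoint step become minus the partial gradients of r:
      - gamma dt d             in the update of lambda,
      - gamma dt b_i S^T y_k   in the i-th adjoint stage.
    The second one cancels the source term of the stage equations, and the
    remaining homogeneous system Lambda_i = dt S^T sum_j a_ji Lambda_j has only
    the zero solution: it is block triangular, and each diagonal block
    I - dt a_ii S^T is injective since S is skew ([adjoint_stages_eq0]).  The
    update of lambda then subtracts precisely what the forward step had added
    ([adjoint_step_reversal]), and backward induction from lambda_K = y_K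
    carries this reversal through all the steps. *)

Section Dot.
Context {R : realType} {N : nat}.
Implicit Types (u v w : 'cV[R]_N) (a : R) (S : 'M[R]_N).

Lemma dotE u v : dot u v = \sum_i u i 0 * v i 0.
Proof. by rewrite /dot mxE; apply: eq_bigr => i _; rewrite mxE. Qed.

Lemma dotC u v : dot u v = dot v u.
Proof. by rewrite !dotE; apply: eq_bigr => i _; rewrite mulrC. Qed.

Lemma dotDr u v w : dot u (v + w) = dot u v + dot u w.
Proof. by rewrite /dot mulmxDr mxE. Qed.

Lemma dotZr a u v : dot u (a *: v) = a * dot u v.
Proof. by rewrite /dot -scalemxAr mxE. Qed.

Lemma dotDl u v w : dot (u + v) w = dot u w + dot v w.
Proof. by rewrite dotC dotDr !(dotC w). Qed.

Lemma dotZl a u v : dot (a *: u) v = a * dot u v.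
Proof. by rewrite dotC dotZr dotC. Qed.

Lemma dotNr u v : dot u (- v) = - dot u v.
Proof. by rewrite -scaleN1r dotZr mulN1r. Qed.

Lemma dot_suml (I : finType) (F : I -> 'cV[R]_N) v :
  dot (\sum_i F i) v = \sum_i dot (F i) v.
Proof. by rewrite /dot raddf_sum mulmx_suml summxE. Qed.

Lemma dot_mulmxr S u v : dot u (S *m v) = dot (S^T *m u) v.
Proof. by rewrite /dot trmx_mul trmxK mulmxA. Qed.

Lemma dot_delta u i : dot u (delta_mx i 0) = u i 0.
Proof. by rewrite /dot -colE !mxE. Qed.

Lemma dot_eq0 u : dot u u = 0 -> u = 0.
Proof.
move=> /eqP; rewrite dotE psumr_eq0; last by move=> i _; rewrite -expr2 sqr_ge0.
move=> /allP u0; apply/colP => i; rewrite mxE.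
by have := u0 i (mem_index_enum _); rewrite /= mulf_eq0 orbb => /eqP.
Qed.

Lemma dot_skew S u : S^T = - S -> dot u (S *m u) = 0.
Proof.
move=> Sskew; have /eqP : dot u (S *m u) = - dot u (S *m u).
  by rewrite {1}dot_mulmxr Sskew mulNmx dotC dotNr.
by rewrite eq_sym eqNr => /eqP.
Qed.

(** The eigenvalues of a skew matrix are purely imaginary, so I - a S is
    injective for every real a; the proof pairs the equation with u. *)
Lemma skew_fixed_eq0 S a u : S^T = - S -> u = a *: (S *m u) -> u = 0.
Proof.
by move=> Sskew uE; apply: dot_eq0; rewrite {2}uE dotZr dot_skew // mulr0.
Qed.

Lemma half_sqnormE u : half_sqnorm u = 2^-1 * dot u u.
Proof.
rewrite /half_sqnorm /enorm sqr_sqrtr; last by apply: sumr_ge0 => i _; exact: sqr_ge0.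
by rewrite dotE; congr (_ * _); apply: eq_bigr => i _; rewrite expr2.
Qed.

Lemma half_sqnorm_line u v a :
  half_sqnorm (a *: v + u) =
  half_sqnorm u + a * dot u v + a ^+ 2 * half_sqnorm v.
Proof. by rewrite !half_sqnormE !(dotDl, dotDr, dotZl, dotZr) (dotC v u); field. Qed.

End Dot.

(** All functions below are quadratic along lines, so their directional
    derivatives can be read off as linear coefficients. *)
Lemma derive_quadratic (R : realType) (V : normedModType R) (f : V -> R^o)
    (x v : V) (l q : R) :
  (forall h : R, f (h *: v + x) = f x + h * l + h ^+ 2 * q) -> 'D_v f x = l.
Proof.
move=> fE; apply: cvg_lim => //.
have lqE : {near (0 : R)^'%classic, (fun h : R => l + h * q : R^o) =1
    (fun h : R => h^-1 *: (f (h *: v + x) - f x) : R^o)}.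
  near=> h; rewrite fE /GRing.scale /=.
  have h0 : h != 0 by near: h; exact: nbhs_dnbhs_neq.
  by field.
apply: cvg_trans (near_eq_cvg lqE) _.
have l0E : l = l + 0 * q by rewrite mul0r addr0.
rewrite [X in cvg_to _ (nbhs X)]l0E; apply: cvgD; first exact: cvg_cst.
by apply: cvgMr_tmp; exact: nbhs_dnbhs.
Unshelve. all: by end_near. Qed.

Section QuadraticEntropy.
Context {R : realType} {N s : nat}.
Implicit Types (y : 'cV[R]_N).

Lemma gradient_half_sqnorm y : gradient half_sqnorm y = y.
Proof.
apply/colP => i; rewrite mxE.
apply: (derive_quadratic (q := half_sqnorm (delta_mx i 0))) => h.
by rewrite half_sqnorm_line dot_delta.
Qed.

Context (b : 'cV[R]_s) (dt : R) (S : 'M[R]_N).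
Hypothesis S_skew : S^T = - S.
Implicit Types (Y : 'I_s -> 'cV[R]_N) (gam : R).

Let direction Y := \sum_i b i 0 *: (S *m Y i).

(** The entropy production term drops out: it is a sum of <Y_i, S Y_i>. *)
Lemma entropy_residualE gam y Y :
  entropy_residual b dt S half_sqnorm gam y Y =
  half_sqnorm (y + (gam * dt) *: direction Y) - half_sqnorm y.
Proof.
rewrite /entropy_residual [X in _ - _ * X]big1 ?mulr0 ?subr0 // => i _.
by rewrite gradient_half_sqnorm dot_skew // mulr0.
Qed.

(** The chain rule: dr/dgamma pairs the direction with the gradient of the
    entropy at the new point, which is the new point itself. *)
Lemma residual_dgammaE gam y Y :
  residual_dgamma b dt S half_sqnorm gam y Y =
  adjoint_xi b dt S Y (y + (gam * dt) *: direction Y).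
Proof.
rewrite /residual_dgamma derive1E.
have -> : adjoint_xi b dt S Y (y + (gam * dt) *: direction Y) =
          dt * dot (y + (gam * dt) *: direction Y) (direction Y).
  rewrite /adjoint_xi [in RHS]dotC {3}/direction dot_suml.
  by congr (_ * _); apply: eq_bigr => i _; rewrite dotZl.
apply: (derive_quadratic (q := dt ^+ 2 * half_sqnorm (direction Y))) => h.
rewrite !entropy_residualE.
have -> : y + ((h *: (1 : R) + gam) * dt) *: direction Y =
    (h * dt) *: direction Y + (y + (gam * dt) *: direction Y).
  by rewrite [h *: 1]mulr1 mulrDl scalerDl addrCA.
by rewrite half_sqnorm_line; ring.
Qed.

(** The Hessian of the entropy is the identity, so the difference of its
    gradients at the new and the old point is the increment itself. *)
Lemma residual_grad_yE gam y Y :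
  residual_grad_y b dt S half_sqnorm gam y Y = (gam * dt) *: direction Y.
Proof.
apply/colP => i; rewrite mxE.
apply: (derive_quadratic (q := 0)) => h.
rewrite !entropy_residualE -addrA !half_sqnorm_line dotDl !dot_delta.
by ring.
Qed.

(** Only the new point depends on Y_i, through gamma dt b_i S; its transpose
    acts on the gradient of the entropy there. *)
Lemma residual_grad_YE gam y Y i :
  residual_grad_Y b dt S half_sqnorm gam y Y i =
  (gam * dt * b i 0) *: (S^T *m (y + (gam * dt) *: direction Y)).
Proof.
apply/colP => l; rewrite mxE.
set e := delta_mx l 0 : 'cV[R]_N.
apply: (derive_quadratic
  (q := half_sqnorm ((gam * dt * b i 0) *: (S *m e)))) => h.
have dirE x : direction [eta Y with i |-> x + Y i] =
    b i 0 *: (S *m x) + direction Y.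
  rewrite /direction (bigD1 i) //= eqxx mulmxDr scalerDr.
  rewrite [in RHS](bigD1 i) //= addrA; congr (_ + _).
  by apply: eq_bigr => j /negbTE ji; rewrite ji.
have dirE0 : direction [eta Y with i |-> Y i] = direction Y.
  by rewrite -[Y i in LHS]add0r dirE mulmx0 scaler0 add0r.
rewrite !entropy_residualE dirE dirE0.
have -> : y + (gam * dt) *: (b i 0 *: (S *m (h *: e)) + direction Y) =
    h *: ((gam * dt * b i 0) *: (S *m e)) + (y + (gam * dt) *: direction Y).
  rewrite scalerDr addrCA; congr (_ + _).
  by rewrite -scalemxAr !scalerA; congr (_ *: _); ring.
rewrite half_sqnorm_line dotZr dot_mulmxr dot_delta !mxE.
by ring.
Qed.

(** The system is upper block triangular, so it is solved from the last stage
    backwards, each diagonal block being injective. *)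
Lemma adjoint_stages_eq0 (A : 'M[R]_s) (Lam : 'I_s -> 'cV[R]_N) :
  (forall i j : 'I_s, (i < j)%N -> A i j = 0) ->
  (forall i, Lam i = dt *: (S^T *m \sum_j A j i *: Lam j)) ->
  forall i, Lam i = 0.
Proof.
move=> A_dirk LamE i.
have [n] := ubnP (s - i); elim: n i => // n IHn i lt_n.
have sumE : \sum_j A j i *: Lam j = A i i *: Lam i.
  rewrite (bigD1 i) //= big1 ?addr0 // => j ji.
  have [ltji|ltij|eqij] := ltngtP j i; first by rewrite A_dirk ?scale0r.
    rewrite IHn ?scaler0 //; rewrite ltnS in lt_n; apply: leq_trans lt_n.
    by rewrite ltn_sub2l.
  by rewrite (val_inj eqij) eqxx in ji.
apply: (skew_fixed_eq0 (S := S) (a := - (dt * A i i))) => //.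
by rewrite [LHS]LamE sumE S_skew mulNmx -scalemxAr scalerN scalerA scaleNr.
Qed.

(** Started from the end point of the forward step, xi equals dr/dgamma, so
    that xi times a gradient of gamma is minus the gradient of r. *)
Lemma adjoint_step_reversal (A : 'M[R]_s) yprev Y gam ynext lamprev :
  (forall i j : 'I_s, (i < j)%N -> A i j = 0) ->
  idt_step A b dt S half_sqnorm yprev Y gam ynext ->
  (exists Lam, adjoint_idt_step A b dt S half_sqnorm yprev Y gam 0 (fun=> 0)
                 ynext Lam lamprev) <-> lamprev = yprev.
Proof.
move=> A_dirk [_ _ dr_neq0 ynextE].
have xiE : adjoint_xi b dt S Y ynext =
    residual_dgamma b dt S half_sqnorm gam yprev Y.
  by rewrite residual_dgammaE -ynextE.
have xi_grad g : adjoint_xi b dt S Y ynext *: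
    - ((residual_dgamma b dt S half_sqnorm gam yprev Y)^-1 *: g) = - g :> 'cV[R]_N.
  by rewrite xiE scalerN scalerA divff // scale1r.
have stageE (Lam : 'I_s -> 'cV[R]_N) i :
    dt *: (S^T *m ((gam * b i 0) *: ynext + \sum_j A j i *: Lam j))
    + adjoint_xi b dt S Y ynext *: gamma_grad_Y b dt S half_sqnorm gam yprev Y i
    + 0 = dt *: (S^T *m \sum_j A j i *: Lam j).
  rewrite /gamma_grad_Y xi_grad residual_grad_YE -ynextE addr0.
  rewrite mulmxDr scalerDr -scalemxAr scalerA addrAC mulrA [dt * gam]mulrC.
  by rewrite subrr add0r.
have updateE : ynext + adjoint_xi b dt S Y ynext *:
    gamma_grad_y b dt S half_sqnorm gam yprev Y = yprev.
  by rewrite /gamma_grad_y xi_grad residual_grad_yE ynextE addrK.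
split=> [[Lam [LamE ->]] | ->].
  rewrite big1 => [|i _]; first by rewrite !addr0 updateE.
  by apply: (adjoint_stages_eq0 A_dirk) => {}i; rewrite [LHS]LamE stageE.
exists (fun=> 0); split=> [i|]; last by rewrite big1_eq !addr0 updateE.
by rewrite stageE big1 ?mulmx0 ?scaler0 // => j _; rewrite scaler0.
Qed.

End QuadraticEntropy.

Theorem theorem2 (R : realType) (N s K : nat)
    (A : 'M[R]_s) (b : 'cV[R]_s) (dt : R) (S : 'M[R]_N) (yinit : 'cV[R]_N)
    (y : nat -> 'cV[R]_N) (Y : nat -> 'I_s -> 'cV[R]_N) (gam : nat -> R)
    (dt_gt0 : 0 < dt)
    (S_skew : S^T = - S)
    (A_dirk : forall i j : 'I_s, (i < j)%N -> A i j = 0)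
    (y_idt : idt_solution A b dt S half_sqnorm K yinit y Y gam) :
  time_symmetric A b dt S half_sqnorm K y Y gam /\
  (forall (lam : nat -> 'cV[R]_N) (Lam : nat -> 'I_s -> 'cV[R]_N),
     adjoint_idt_solution A b dt S half_sqnorm K y Y gam
       (y K) (fun=> 0) (fun _ _ => 0) lam Lam ->
     forall k, (k <= K)%N -> lam k = y k).
Proof.
have symm : time_symmetric A b dt S half_sqnorm K y Y gam.
  by move=> k kK lamprev; apply: adjoint_step_reversal => //; apply: y_idt.2.
split=> // lam Lam [lamK lamE] k kK.
rewrite -(subKn kK); elim: (K - k)%N => [|m IHm]; first by rewrite subn0.
have [mK|Km] := ltnP m K; last first.
  (* Truncated subtraction: below index 0 the claim only repeats itself. *)
  have Km0 : (K - m)%N = 0%N by apply/eqP.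
  by move: IHm; rewrite subnS Km0.
have step : (1 <= K - m <= K)%N by rewrite subn_gt0 mK leq_subr.
rewrite subnS; apply/(symm _ step); exists (Lam (K - m)%N).
by rewrite -IHm; exact: lamE.
Qed.
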